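(* Let $V:\mathbb{R}^2\to[-\infty,+\infty]$ be continuous, and smooth away from its collision points (the points where $V=\pm\infty$). Consider Newton's equations $\ddot q=-\nabla V(q)$, with conserved energy $\frac12|\dot q|^2+V(q)$, and let $E\in\mathbb{R}$. Then, away from collisions and brake points, every energy $E$ solution to Newton's equations is the reparameterization of a geodesic for the energy $E$ Jacobi-Maupertuis metric $$ds_{JM}^2=2(E-V(q))\,|dq|^2$$ on the Hill region $\{q: V(q)\le E\}$. Conversely, away from collisions and the Hill boundary $\{q: V(q)=E\}$, every geodesic of $ds_{JM}^2$ is a reparameterization of an energy $E$ solution of Newton's equations.
   Context: Here $|dq|^2=dx^2+dy^2$ for $q=(x,y)\in\mathbb{R}^2$. The metric $ds_{JM}^2$ is a Riemannian metric on the interior part $\{V<E\}$ of the Hill region away from collision points, and degenerates on the Hill boundary $\{V=E\}$. A brake point of a solution $q(t)$ is a point $q(t_0)$ with $\dot q(t_0)=0$; for an energy $E$ solution this is equivalent to $q(t_0)$ lying on the Hill boundary. *)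

(* Defs.v *)
From HB Require Import structures.
From mathcomp Require Import all_boot all_order all_algebra.
From mathcomp Require Import all_classical all_reals all_analysis.

Set Implicit Arguments.
Unset Strict Implicit.
Unset Printing Implicit Defensive.
Import Order.TTheory GRing.Theory Num.Theory.
Import numFieldNormedType.Exports.

Local Open Scope ring_scope.
Local Open Scope classical_set_scope.

Definition partial (R : realType) (i : 'I_2) (f : 'rV[R]_2 -> R) :
  'rV[R]_2 -> R := 'D_(delta_mx 0 i) f.

Fixpoint Ck (R : realType) (k : nat) (U : set 'rV[R]_2) (f : 'rV[R]_2 -> R) :
    Prop :=
  match k with
  | 0%N => forall x, U x -> {for x, continuous f}
  | k'.+1 => (forall x, U x -> differentiable f x) /\
             (forall i : 'I_2, Ck k' U (partial i f))
  end.

Definition smooth_on (R : realType) (U : set 'rV[R]_2) (f : 'rV[R]_2 -> R) :=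
  forall k, Ck k U f.

Definition open_interval (R : realType) (I : set R) :=
  [/\ open I, is_interval I & I !=set0].

(* Orientation preserving smooth diffeomorphism; the inverse is smooth because
   the derivative does not vanish. *)
Definition diffeo (R : realType) (I J : set R) (phi : R -> R) :=
  [/\ set_bij I J phi,
      forall (n : nat) t, I t -> derivable (phi^`(n)) t 1
    & forall t, I t -> 0 < phi^`() t].

Definition reparameterization (R : realType) (I : set R) (c : R -> 'rV[R]_2)
    (J : set R) (c0 : R -> 'rV[R]_2) :=
  exists2 phi : R -> R, diffeo I J phi & forall t, I t -> c t = c0 (phi t).

(* The metric is g = \sum_(i, j) g_ij dx_i dx_j, with (g x) i j = g_ij(x);
   [christoffel g k i j] is Gamma^k_ij of the Levi-Civita connection. *)
Definition christoffel (R : realType) (g : 'rV[R]_2 -> 'M[R]_2)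
    (k i j : 'I_2) (x : 'rV[R]_2) : R :=
  2^-1 * \sum_(l < 2) invmx (g x) k l *
    (partial i (fun y => g y j l) x + partial j (fun y => g y i l) x
     - partial l (fun y => g y i j) x).

(* Affinely parameterized geodesics of the metric g on the open set U; constant
   curves are included. *)
Definition geodesic (R : realType) (U : set 'rV[R]_2)
    (g : 'rV[R]_2 -> 'M[R]_2) (I : set R) (c : R -> 'rV[R]_2) :=
  forall t, I t ->
    [/\ U (c t), derivable c t 1, derivable (derive1 c) t 1
      & forall k : 'I_2,
          derive1 (derive1 c) t 0 k
          + \sum_(i < 2) \sum_(j < 2)
              christoffel g k i j (c t) * derive1 c t 0 i * derive1 c t 0 j = 0].

Definition collision (R : realType) (V : 'rV[R]_2 -> \bar R) :
  set 'rV[R]_2 := [set x | V x = +oo%E \/ V x = -oo%E].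

(* V is real-valued off its collision points; [potential V] is junk at them. *)
Definition potential (R : realType) (V : 'rV[R]_2 -> \bar R) : 'rV[R]_2 -> R :=
  fun x => fine (V x).

Definition gradient (R : realType) (f : 'rV[R]_2 -> R) (x : 'rV[R]_2) :
  'rV[R]_2 := \row_i partial i f x.

(* The norm of 'rV[R]_2 in the library is the sup norm, not the Euclidean one
   used here. *)
Definition energy (R : realType) (V : 'rV[R]_2 -> \bar R) (q : R -> 'rV[R]_2)
    (t : R) : R :=
  2^-1 * (\sum_(i < 2) (derive1 q t 0 i) ^+ 2) + potential V (q t).

Definition newton_solution (R : realType) (V : 'rV[R]_2 -> \bar R)
    (I : set R) (q : R -> 'rV[R]_2) :=
  forall t, I t ->
    [/\ ~ collision V (q t), derivable q t 1, derivable (derive1 q) t 1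
      & derive1 (derive1 q) t = - gradient (potential V) (q t)].

Definition energy_solution (R : realType) (V : 'rV[R]_2 -> \bar R) (E : R)
    (I : set R) (q : R -> 'rV[R]_2) :=
  newton_solution V I q /\ (forall t, I t -> energy V q t = E).

Definition brake (R : realType) (q : R -> 'rV[R]_2) (t : R) := derive1 q t = 0.

Definition hill_region (R : realType) (V : 'rV[R]_2 -> \bar R) (E : R) :
  set 'rV[R]_2 := [set x | (V x <= E%:E)%E].

Definition hill_boundary (R : realType) (V : 'rV[R]_2 -> \bar R) (E : R) :
  set 'rV[R]_2 := [set x | V x = E%:E].

Definition regular_hill_region (R : realType) (V : 'rV[R]_2 -> \bar R)
    (E : R) : set 'rV[R]_2 :=
  hill_region V E `\` (hill_boundary V E `|` collision V).

Definition jm_metric (R : realType) (V : 'rV[R]_2 -> \bar R) (E : R)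
    (x : 'rV[R]_2) : 'M[R]_2 :=
  (2 * (E - potential V x)) *: 1%:M.

(* Main.v *)
Require Import Defs.
From mathcomp Require Import all_boot all_order all_algebra.
From mathcomp Require Import all_classical all_reals all_analysis.
From mathcomp Require Import ring lra.
Import Order.TTheory GRing.Theory Num.Theory.
Import numFieldNormedType.Exports.
Local Open Scope ring_scope.
Local Open Scope classical_set_scope.

(** The Jacobi-Maupertuis metric is conformally flat, with conformal factor
    lam = 2 (E - V), where E - V > 0. The geodesic equation reads
      c'' = lam^-1 (2 (grad V . c') c' - |c'|^2 grad V),
    because the Christoffel symbols only involve the logarithmic derivatives of
    lam, and grad lam = -2 grad V ([jm_geodesicP]). The second term is Newton's
    force, up to the scale of time, and a multiple of the velocity is removed
    or created by a change of time. The correct change is dictated by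
    conservation laws. The energy of a Newton solution says |q'|^2 = lam, so
    that a unit speed geodesic has parameter s with ds/dt = sqrt lam |q'| = lam.
    Conversely a geodesic has
    constant Riemannian speed, lam |c'|^2 = e ([jm_speed_constant]), and
    dt/ds = sqrt e / lam makes its Euclidean speed the one prescribed by the
    energy E. Both rates are constant multiples of the squared Euclidean speed
    of the given curve, with factor 1 and (sqrt e)^-1, so one lemma,
    [speed_time_change], constructs the new parameter in both directions and
    computes the new velocity and acceleration.

    That lemma integrates the rate ([primitive_exists]) and inverts the
    resulting increasing function ([time_change]). A reparameterization is
    required to be smooth, whereas the curves are given as twice differentiable
    solutions of second order equations. The regularity comes from a bootstrap:
    polynomials in the velocity, with coefficients smooth functions of the
    position, form an algebra ([along_curve]) which contains the acceleration
    because of the equation of motion, hence is stable under differentiation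
    ([along_curve_derivation]), hence consists of smooth functions
    ([derivation_closed_smooth]). *)

Set Implicit Arguments.
Unset Strict Implicit.
Unset Printing Implicit Defensive.

(** * Calculus on an open interval *)

Lemma open_interval_bracket (R : realType) (I : set R) (t : R) :
  open_interval I -> I t -> exists u v, [/\ I u, I v, u < t & t < v].
Proof.
move=> [oI _ _] It; have /nbhs_ballP[e /= e0 eI] : nbhs t I by exact: open_nbhs_nbhs.
exists (t - e / 2), (t + e / 2).
have e2 : 0 < e / 2 by rewrite divr_gt0.
split; [apply: eI|apply: eI|lra|lra]; rewrite /ball/=.
- by rewrite opprB addrC subrK gtr0_norm//; lra.
- by rewrite opprD addrA subrr add0r normrN gtr0_norm//; lra.
Qed.

Lemma open_interval_itv (R : realType) (I : set R) (u v t : R) :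
  open_interval I -> I u -> I v -> u <= t <= v -> I t.
Proof. by move=> [_ iI _] Iu Iv; exact: iI. Qed.

Lemma near_open_interval (R : realType) (I : set R) (t : R) :
  open_interval I -> I t -> \forall x \near t, I x.
Proof. by move=> [oI _ _] It; exact: open_nbhs_nbhs. Qed.

(** The primitive based at b is an oriented integral, so its formula changes at
    b. Near any given time it equals, up to a constant, the integral from a
    point u to the left of both that time and b, and the fundamental theorem of
    calculus applies to the latter. *)
Lemma primitive_exists (R : realType) (I : set R) (h : R -> R) :
  open_interval I -> (forall t, I t -> {for t, continuous h}) ->
  exists phi : R -> R, forall t, I t -> is_derive t 1 phi (h t).
Proof.
move=> oI hc; have [_ _ [b Ib]] := oI.
pose G u t := (\int[lebesgue_measure]_(x in `[u, t]) h x)%R.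
have hint u v : I u -> I v -> lebesgue_measure.-integrable `[u, v] (EFin \o h).
  move=> Iu Iv; apply: continuous_compact_integrable; first exact: segment_compact.
  apply/continuous_in_subspaceT => x; rewrite inE/= in_itv/= => uxv.
  exact/hc/(open_interval_itv oI Iu Iv).
have Gsplit u m v : I u -> I v -> u <= m <= v -> G u v = G u m + G m v.
  move=> Iu Iv /andP[um mv].
  have Im : I m by apply: (open_interval_itv oI Iu Iv); rewrite um mv.
  have := @Rintegral_itvB R h (BLeft u) (BRight v) m (hint _ _ Iu Iv).
  rewrite !bnd_simp um mv => /(_ isT isT).
  rewrite Rintegral_itv_obnd_cbnd; last first.
    apply: (integrableS _ _ _ (hint _ _ Im Iv)) => //.
    exact: subset_itv_oc_cc.
  by move=> E; rewrite /G -E addrC subrK.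
exists (fun t => if b <= t then G b t else - G t b) => t It.
have [u1 [v1 [Iu1 Iv1 u1t tv1]]] := open_interval_bracket oI It.
have [u2 [_ [Iu2 _ u2b _]]] := open_interval_bracket oI Ib.
(* u lies to the left of both t and b, so that G u t avoids the case split. *)
pose u := Num.min u1 u2.
have Iu : I u by rewrite /u /Num.min; case: ifP.
have ut : u < t by rewrite /u gt_min u1t.
have ub : u < b by rewrite /u gt_min u2b orbT.
have [dG G't] : derivable (G u) t 1 /\ derive1 (G u) t = h t.
  apply: (continuous_FTC1_closed tv1) => //; first exact: hint.
  exact: hc.
have : is_derive t 1 (fun x => G u x - G u b) (h t).
  have dGt : is_derive t 1 (G u) (h t).
    by apply: DeriveDef => //; rewrite -derive1E.
  by apply: is_derive_eq; rewrite subr0.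
apply: near_eq_is_derive.
near=> x.
have Ix : I x by near: x; exact: near_open_interval.
have ux : u < x by near: x; exact: lt_nbhsr.
case: leP => bx.
  by rewrite (Gsplit u b x)// ?(ltW ub)// addrAC subrr add0r.
by rewrite (Gsplit u x b)// ?(ltW ux) ?(ltW bx)// opprD addrA subrr add0r.
Unshelve. all: by end_near. Qed.

Lemma eq_derive1n (R : realType) (I : set R) (f g : R -> R) :
  open_interval I -> (forall t, I t -> f t = g t) ->
  forall n t, I t -> derive1n n f t = derive1n n g t.
Proof.
move=> oI fg; elim=> [|n IHn] t It; first exact: fg.
rewrite !derive1nS !derive1E; apply: near_eq_derive; near=> x.
by apply: IHn; near: x; exact: near_open_interval.
Unshelve. all: by end_near. Qed.

Lemma eq_derivable1n (R : realType) (I : set R) (f g : R -> R) :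
  open_interval I -> (forall t, I t -> f t = g t) ->
  forall n t, I t -> derivable (derive1n n g) t 1 -> derivable (derive1n n f) t 1.
Proof.
move=> oI fg n t It; apply: near_eq_derivable; near=> x.
apply/esym/(eq_derive1n oI fg); near: x; exact: near_open_interval.
Unshelve. all: by end_near. Qed.

(** A coinduction principle: a family of functions stable under differentiation
    consists of smooth functions. It spares all explicit formulas for higher
    derivatives, since only first derivatives have to be computed. *)
Lemma derivation_closed_smooth (R : realType) (I : set R) (A : set (R -> R)) :
  open_interval I ->
  (forall h, A h -> exists2 h', A h' & forall t, I t -> is_derive t 1 h (h' t)) ->
  forall h, A h -> forall n t, I t -> derivable (derive1n n h) t 1.
Proof.
move=> oI Ad h Ah n; elim: n h Ah => [|n IHn] h /Ad[h' Ah' dh] t It.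
  by have dt := dh _ It.
rewrite derive1Sn; apply: (eq_derivable1n (g := h') oI) => //; last exact: IHn.
by move=> x /dh dx; rewrite derive1E (@derive_val _ _ _ _ _ _ _ dx).
Qed.

Lemma positive_derivative_lt (R : realType) (I : set R) (phi w : R -> R) :
  open_interval I -> (forall t, I t -> is_derive t 1 phi (w t)) ->
  (forall t, I t -> 0 < w t) ->
  forall a b, I a -> I b -> a < b -> phi a < phi b.
Proof.
move=> oI dphi w0 a b Ia Ib ab.
have Iab x : a <= x <= b -> I x by exact: open_interval_itv.
have [|x xab|c cab E] := @MVT R phi w a b ab.
- by move=> x xab; apply/dphi/Iab; move: xab; rewrite in_itv/= => /andP[/ltW -> /ltW ->].
- apply: continuous_in_subspaceT xab => y; rewrite inE/= in_itv/= => /Iab/dphi yd.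
  exact/differentiable_continuous/derivable1_diffP.
rewrite -subr_gt0 E mulr_gt0 ?subr_gt0//; apply/w0/Iab.
by move: cab; rewrite in_itv/= => /andP[/ltW -> /ltW ->].
Qed.

Lemma positive_derivative_image (R : realType) (I : set R) (phi w : R -> R) :
  open_interval I -> (forall t, I t -> is_derive t 1 phi (w t)) ->
  (forall t, I t -> 0 < w t) ->
  open_interval (phi @` I).
Proof.
move=> oI dphi w0; have lt_phi := positive_derivative_lt oI dphi w0.
have iJ : is_interval (phi @` I).
  apply/connected_intervalP/connected_continuous_connected.
    by apply/connected_intervalP; case: oI.
  apply/continuous_in_subspaceT => y; rewrite inE => /dphi yd.
  exact/differentiable_continuous/derivable1_diffP.
split=> //; last first.
  by have [_ _ [b Ib]] := oI; exists (phi b), b.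
rewrite openE => _ [t It <-].
have [u [v [Iu Iv ut tv]]] := open_interval_bracket oI It.
have H : \forall y \near phi t, phi u < y < phi v.
  near=> y; apply/andP; split; near: y.
    exact/lt_nbhsr/lt_phi.
  exact/lt_nbhsl/lt_phi.
apply: filterS H => y /andP[/ltW uy /ltW yv].
apply: (iJ (phi u) (phi v)); [by exists u|by exists v|by rewrite uy yv].
Unshelve. all: by end_near. Qed.

Lemma derivative0_constant (R : realType) (I : set R) (h : R -> R) :
  open_interval I -> (forall t, I t -> is_derive t 1 h 0) ->
  forall a b, I a -> I b -> h a = h b.
Proof.
move=> oI dh a b Ia Ib.
wlog ab : a b Ia Ib / a <= b.
  by move=> H; case: (leP a b) => [|/ltW] ab; [|apply/esym]; exact: H.
have Iab x : a <= x <= b -> I x by exact: open_interval_itv.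
have [x||c _] := @MVT_segment R h (cst 0) a b ab.
- by rewrite in_itv/= => /andP[/ltW ax /ltW xb]; apply/dh/Iab; rewrite ax.
- apply: continuous_in_subspaceT => y; rewrite inE/= in_itv/= => /Iab/dh yd.
  exact/differentiable_continuous/derivable1_diffP.
by rewrite mul0r => /eqP; rewrite subr_eq0 => /eqP.
Qed.

(** Injectivity on I gives a left inverse psi, and since I is open the identity
    psi o phi = id holds near every point of I, which is what the inverse
    function rule requires. *)
Lemma positive_derivative_inverse (R : realType) (I : set R) (phi w : R -> R) :
  open_interval I -> (forall t, I t -> is_derive t 1 phi (w t)) ->
  (forall t, I t -> 0 < w t) ->
  exists psi : R -> R, forall t, I t ->
    psi (phi t) = t /\ is_derive (phi t) 1 psi (w t)^-1.
Proof.
move=> oI dphi w0; have lt_phi := positive_derivative_lt oI dphi w0.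
have phi_inj a b : I a -> I b -> phi a = phi b -> a = b.
  move=> Ia Ib ab; case: (ltgtP a b) => // /lt_phi.
  - by rewrite ab ltxx => /(_ Ia Ib).
  - by rewrite ab ltxx => /(_ Ib Ia).
pose psi y := xget 0 [set t | I t /\ phi t = y].
have psiK t : I t -> psi (phi t) = t.
  move=> It; rewrite /psi; case: xgetP => [x _ [Ix xt]|/(_ t)]; first exact: phi_inj.
  by case.
exists psi => t It; split; first exact: psiK.
apply: is_derive_inverse; last by rewrite gt_eqF// w0.
- by near=> x; apply: psiK; near: x; exact: near_open_interval.
- near=> x; have Ix : I x by near: x; exact: near_open_interval.
  by have dx := dphi _ Ix; exact/differentiable_continuous/derivable1_diffP.
- exact: dphi.
Unshelve. all: by end_near. Qed.

Lemma is_derive_scale_comp (R : realType) (W : normedModType R) (r : R -> W)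
    (psi : R -> R) (u l : R) :
  derivable r (psi u) 1 -> is_derive u 1 psi l ->
  is_derive u 1 (r \o psi) (l *: derive1 r (psi u)).
Proof.
move=> /derivable1_diffP dr dpsi.
have dpsi' : differentiable psi u by exact/derivable1_diffP.
apply: DeriveDef.
  exact/derivable1_diffP/differentiable_comp.
rewrite deriveE; last exact: differentiable_comp.
have dpsiE : 'd psi u 1 = l by rewrite -deriveE// (@derive_val _ _ _ _ _ _ _ dpsi).
rewrite diff_comp//= dpsiE derive1E deriveE//.
by rewrite -[in LHS](mulr1 l) -[l * 1]/(l *: 1) linearZ.
Qed.

(** Any smooth positive w is the rate d(phi)/dt of a new time phi. The curve is
    transported to the new time by the inverse of phi, and d/d(phi) = w^-1 d/dt
    gives both derivatives; v is the new velocity seen in the old time. *)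
Lemma time_change (R : realType) (W : normedModType R) (I : set R)
    (r : R -> W) (w : R -> R) :
  let v t := (w t)^-1 *: derive1 r t in
  open_interval I ->
  (forall t, I t -> 0 < w t) ->
  (forall n t, I t -> derivable (derive1n n w) t 1) ->
  (forall t, I t -> derivable r t 1) ->
  (forall t, I t -> derivable v t 1) ->
  exists (J : set R) (phi : R -> R) (s : R -> W),
    [/\ open_interval J, diffeo I J phi, forall t, I t -> r t = s (phi t)
      & forall u, J u -> exists2 t, I t &
        [/\ s u = r t, is_derive u 1 s (v t)
          & is_derive u 1 (derive1 s) ((w t)^-1 *: derive1 v t)]].
Proof.
move=> v oI w0 wsmooth dr dv.
have [phi dphi] : exists phi : R -> R, forall t, I t -> is_derive t 1 phi (w t).
  apply: primitive_exists => // t It.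
  exact/differentiable_continuous/derivable1_diffP/(wsmooth 0%N).
have phi_w t : I t -> derive1 phi t = w t.
  by move=> /dphi dt; rewrite derive1E (@derive_val _ _ _ _ _ _ _ dt).
have oJ := positive_derivative_image oI dphi w0.
have [psi Hpsi] := positive_derivative_inverse oI dphi w0.
have ds t : I t -> is_derive (phi t) 1 (r \o psi) (v t).
  move=> It; have [psit dpsi] := Hpsi _ It.
  by have := @is_derive_scale_comp R W r psi (phi t) _ _ dpsi; rewrite psit; apply; exact: dr.
exists (phi @` I), phi, (r \o psi); split => //.
- split.
  + split; first by move=> t It; exists t.
      move=> a b; rewrite !inE => Ia Ib ab.
      by rewrite -(Hpsi a Ia).1 ab (Hpsi b Ib).1.
    by move=> _ [t It <-]; exists t.
  + case=> [|n] t It; first by have dt := dphi _ It.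
    by rewrite derive1Sn; apply: (eq_derivable1n (g := w) oI) => //; exact: wsmooth.
  + by move=> t It; rewrite phi_w// w0.
- by move=> t It /=; rewrite (Hpsi _ It).1.
- move=> _ [t It <-]; exists t => //; split; first by rewrite /= (Hpsi _ It).1.
    exact: ds.
  have [psit dpsi] := Hpsi _ It.
  have := @is_derive_scale_comp R W v psi (phi t) _ _ dpsi; rewrite psit => /(_ (dv _ It)).
  apply: near_eq_is_derive; near=> y.
  have [x Ix <-] : (phi @` I) y.
    by near: y; apply: near_open_interval => //; exists t.
  by have dsx := ds _ Ix; rewrite derive1E (@derive_val _ _ _ _ _ _ _ dsx) /= (Hpsi _ Ix).1.
Unshelve. all: by end_near. Qed.

(** * Euclidean inner product and derivatives of curves *)

Definition dot (R : realType) (u v : 'rV[R]_2) : R :=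
  \sum_(i < 2) u 0 i * v 0 i.

Lemma dotC (R : realType) (u v : 'rV[R]_2) : dot u v = dot v u.
Proof. by apply: eq_bigr => i _; rewrite mulrC. Qed.

Lemma dotDr (R : realType) (u v w : 'rV[R]_2) :
  dot u (v + w) = dot u v + dot u w.
Proof. by rewrite -big_split; apply: eq_bigr => i _; rewrite mxE mulrDr. Qed.

Lemma dotZr (R : realType) (a : R) (u v : 'rV[R]_2) :
  dot u (a *: v) = a * dot u v.
Proof. by rewrite mulr_sumr; apply: eq_bigr => i _; rewrite mxE mulrCA. Qed.

Lemma dotNr (R : realType) (u v : 'rV[R]_2) : dot u (- v) = - dot u v.
Proof. by rewrite -scaleN1r dotZr mulN1r. Qed.

Lemma dot_gt0 (R : realType) (u : 'rV[R]_2) : (0 < dot u u) = (u != 0).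
Proof.
have ge0 i : 0 <= u 0 i * u 0 i by rewrite -expr2 sqr_ge0.
rewrite lt_def sumr_ge0// andbT; congr (~~ _); apply/idP/eqP => [|->].
  rewrite psumr_eq0// => /allP u0; apply/rowP => i; rewrite mxE.
  by have := u0 i (mem_index_enum _); rewrite -expr2 sqrf_eq0 => /eqP.
by rewrite /dot big1// => i _; rewrite mxE mul0r.
Qed.

Lemma is_derive_row (R : realType) (y : R -> 'rV[R]_2) (t : R) (d : 'rV[R]_2) :
  is_derive t 1 y d <->
  forall i, is_derive t 1 (fun x => y x 0 i) (d 0 i).
Proof.
split=> [dy i|dy].
  have dery : derivable y t 1 by [].
  apply: DeriveDef; first by move/derivable_mxP : dery.
  by rewrite -[d](@derive_val _ _ _ _ _ _ _ dy) derive_mx// mxE.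
have dery : derivable y t 1.
  by apply/derivable_mxP => i j; rewrite (ord1 i); have dj := dy j.
apply: DeriveDef => //; rewrite derive_mx//; apply/rowP => i; rewrite mxE.
by rewrite (@derive_val _ _ _ _ _ _ _ (dy i)).
Qed.

Lemma is_derive_derive1 (R : realType) (W : normedModType R) (y : R -> W) (t : R) :
  derivable y t 1 -> is_derive t 1 y (derive1 y t).
Proof. by move=> dy; apply: DeriveDef => //; rewrite derive1E. Qed.

Lemma is_derive_dot (R : realType) (y z : R -> 'rV[R]_2) (t : R)
    (dy dz : 'rV[R]_2) :
  is_derive t 1 y dy -> is_derive t 1 z dz ->
  is_derive t 1 (fun x => dot (y x) (z x)) (dot dy (z t) + dot (y t) dz).
Proof.
move=> /is_derive_row Dy /is_derive_row Dz.
pose p i : R -> R := (fun x => y x 0 i) * (fun x => z x 0 i).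
have Dp i : is_derive t 1 (p i) (dy 0 i * z t 0 i + y t 0 i * dz 0 i).
  apply: (is_derive_eq (is_deriveM (Dy i) (Dz i))).
  by rewrite addrC /GRing.scale/= (mulrC (z t 0 i)).
have -> : (fun x => dot (y x) (z x)) = \sum_(i < 2) p i.
  by apply/funext => x; rewrite fct_sumE.
by apply: is_derive_eq (is_derive_sum Dp) _; rewrite big_split.
Qed.

Lemma is_derive_inv_scale (R : realType) (w : R -> R) (y : R -> 'rV[R]_2)
    (t dw : R) (dy : 'rV[R]_2) :
  w t != 0 -> is_derive t 1 w dw -> is_derive t 1 y dy ->
  is_derive t 1 (fun x => (w x)^-1 *: y x)
    ((w t)^-1 *: (dy - ((w t)^-1 * dw) *: y t)).
Proof.
move=> w0 Dw /is_derive_row Dy; apply/is_derive_row => i.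
have -> : (fun x => ((w x)^-1 *: y x) 0 i) = (fun x => (w x)^-1) * (fun x => y x 0 i).
  by apply/funext => x; rewrite mxE.
apply: (is_derive_eq (is_deriveM (is_deriveV w0 Dw) (Dy i))).
by rewrite !mxE /GRing.scale/=; field.
Qed.

Lemma is_derive_along (R : realType) (f : 'rV[R]_2 -> R) (r : R -> 'rV[R]_2)
    (t : R) (dr : 'rV[R]_2) :
  differentiable f (r t) -> is_derive t 1 r dr ->
  is_derive t 1 (f \o r) (dot (gradient f (r t)) dr).
Proof.
move=> df Dr; have dr' : differentiable r t by exact/derivable1_diffP.
apply: DeriveDef; first exact/derivable1_diffP/differentiable_comp.
have drE : 'd r t 1 = dr by rewrite -deriveE// (@derive_val _ _ _ _ _ _ _ Dr).
rewrite deriveE; last exact: differentiable_comp.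
rewrite diff_comp//= drE {1}(row_sum_delta dr) linear_sum/=.
apply: eq_bigr => i _; by rewrite linearZ/= -deriveE// mxE mulrC.
Qed.

(** * Smoothness of the speed along a curve *)

(** The algebra of functions of time generated by the smooth functions of the
    position and by the velocity components. For a curve whose acceleration
    lies in it, this algebra is stable under d/dt: this is how a solution that
    is only assumed to be twice differentiable is seen to be smooth. *)
Inductive along_curve (R : realType) (D : set 'rV[R]_2) (r : R -> 'rV[R]_2) :
    set (R -> R) :=
| AlongSmooth f of smooth_on D f : along_curve D r (f \o r)
| AlongVelocity i : along_curve D r (fun t => derive1 r t 0 i)
| AlongCst a : along_curve D r (cst a)
| AlongAdd h k of along_curve D r h & along_curve D r k :
    along_curve D r (h + k)
| AlongMul h k of along_curve D r h & along_curve D r k :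
    along_curve D r (h * k).

Lemma along_curve_dot (R : realType) (D : set 'rV[R]_2) (r : R -> 'rV[R]_2)
    (y z : R -> 'rV[R]_2) :
  (forall i, along_curve D r (fun t => y t 0 i)) ->
  (forall i, along_curve D r (fun t => z t 0 i)) ->
  along_curve D r (fun t => dot (y t) (z t)).
Proof.
move=> Ay Az; pose F i : R -> R := (fun t => y t 0 i) * (fun t => z t 0 i).
have -> : (fun t => dot (y t) (z t)) = F ord0 + (F (lift ord0 ord0) + cst 0).
  by apply/funext => t; rewrite /dot !big_ord_recl big_ord0.
apply: AlongAdd; first exact: AlongMul.
by apply: AlongAdd; [exact: AlongMul|exact: AlongCst].
Qed.

Lemma smooth_on_partial (R : realType) (D : set 'rV[R]_2) (f : 'rV[R]_2 -> R) i :
  smooth_on D f -> smooth_on D (partial i f).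
Proof. by move=> sf k; have [_] := sf k.+1; apply. Qed.

Lemma along_curve_gradient (R : realType) (D : set 'rV[R]_2) (r : R -> 'rV[R]_2)
    (f : 'rV[R]_2 -> R) i :
  smooth_on D f -> along_curve D r (fun t => gradient f (r t) 0 i).
Proof.
move=> sf; rewrite (_ : (fun _ => _) = partial i f \o r).
  by apply: AlongSmooth; exact: smooth_on_partial.
by apply/funext => t; rewrite mxE.
Qed.

Lemma smooth_on_differentiable (R : realType) (D : set 'rV[R]_2)
    (f : 'rV[R]_2 -> R) x :
  smooth_on D f -> D x -> differentiable f x.
Proof. by move=> sf; have [+ _] := sf 1%N; apply. Qed.

(** By the chain rule the derivative of f along r is the sum of the products of
    its partial derivatives, again smooth, with the velocity components; the
    hypothesis on the acceleration handles the velocity components themselves. *)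
Lemma along_curve_derivation (R : realType) (I : set R) (D : set 'rV[R]_2)
    (r : R -> 'rV[R]_2) :
  (forall t, I t -> [/\ D (r t), derivable r t 1 & derivable (derive1 r) t 1]) ->
  (forall i, exists2 a, along_curve D r a &
     forall t, I t -> derive1 (derive1 r) t 0 i = a t) ->
  forall h, along_curve D r h ->
  exists2 h', along_curve D r h' & forall t, I t -> is_derive t 1 h (h' t).
Proof.
move=> rI acc h; elim=> {h}[f sf|i|a|h k _ [h' Ah' dh] _ [k' Ak' dk]
                           |h k Ah [h' Ah' dh] Ak [k' Ak' dk]].
- exists (fun t => dot (gradient f (r t)) (derive1 r t)).
    by apply: along_curve_dot => i; [exact: along_curve_gradient|exact: AlongVelocity].
  move=> t /rI[Dt dr _]; apply: is_derive_along; last exact: is_derive_derive1.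
  exact: smooth_on_differentiable Dt.
- have [a Aa aE] := acc i; exists a => // t It; rewrite -aE//.
  have [_ _ d2r] := rI _ It.
  by have /is_derive_row := is_derive_derive1 d2r; exact.
- by exists (cst 0) => [|t _]; [exact: AlongCst|exact: is_derive_cst].
- by exists (h' + k'); [exact: AlongAdd|move=> t It; exact: (is_deriveD (dh _ It) (dk _ It))].
- exists (h * k' + k * h'); first by apply: AlongAdd; exact: AlongMul.
  by move=> t It; apply: is_derive_eq (is_deriveM (dh _ It) (dk _ It)) _.
Qed.

(** The time change with rate kappa |r'|^2. A single rate serves for both
    directions of the correspondence: it is 2 (E - V) along an energy E
    solution, and a multiple of (E - V)^-1 along a geodesic. It is a polynomial
    in the velocity, hence smooth by stability of the algebra above. The
    correction to the acceleration is the logarithmic derivative of the rate,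
    in which kappa cancels. *)
Lemma speed_time_change (R : realType) (I : set R) (D : set 'rV[R]_2)
    (r : R -> 'rV[R]_2) (kappa : R) :
  open_interval I -> 0 < kappa ->
  (forall t, I t -> [/\ D (r t), derivable r t 1 & derivable (derive1 r) t 1]) ->
  (forall i, exists2 a, along_curve D r a &
     forall t, I t -> derive1 (derive1 r) t 0 i = a t) ->
  (forall t, I t -> derive1 r t != 0) ->
  exists (J : set R) (s : R -> 'rV[R]_2),
    [/\ open_interval J, reparameterization I r J s
      & forall u, J u -> exists2 t, I t &
        let v := derive1 r t in
        let a := derive1 (derive1 r) t in
        let w := kappa * dot v v in
        [/\ s u = r t, is_derive u 1 s (w^-1 *: v)
          & is_derive u 1 (derive1 s)
              ((w ^+ 2)^-1 *: (a - (2 * dot v a / dot v v) *: v))]].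
Proof.
move=> oI kappa0 rI acc r'0.
pose w t := kappa * dot (derive1 r t) (derive1 r t).
have w0 t : I t -> 0 < w t by move=> It; rewrite mulr_gt0// dot_gt0 r'0.
have w_smooth n t : I t -> derivable (derive1n n w) t 1.
  apply: (derivation_closed_smooth (A := along_curve D r) oI).
    exact: along_curve_derivation.
  rewrite (_ : w = cst kappa * (fun t => dot (derive1 r t) (derive1 r t))) //.
  apply: AlongMul; first exact: AlongCst.
  by apply: along_curve_dot => i; exact: AlongVelocity.
have Dv t : I t -> is_derive t 1 (fun x => (w x)^-1 *: derive1 r x)
    ((w t)^-1 *: (derive1 (derive1 r) t -
      (2 * dot (derive1 r t) (derive1 (derive1 r) t) /
        dot (derive1 r t) (derive1 r t)) *: derive1 r t)).
  move=> It; have [_ _ /is_derive_derive1 d2r] := rI _ It.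
  have v0 : dot (derive1 r t) (derive1 r t) != 0 by rewrite gt_eqF// dot_gt0 r'0.
  have wt0 : w t != 0 by rewrite gt_eqF// w0.
  have Dw : is_derive t 1 w
      (kappa * (2 * dot (derive1 r t) (derive1 (derive1 r) t))).
    apply: is_derive_eq (is_deriveZ kappa (is_derive_dot d2r d2r)) _.
    rewrite /GRing.scale/= (dotC (derive1 (derive1 r) t)).
    by rewrite mulr2n mulrDl mul1r.
  apply: is_derive_eq (is_derive_inv_scale wt0 Dw d2r) _.
  congr (_ *: (_ - _ *: _)); rewrite /w; field.
  by rewrite v0 gt_eqF.
have [||J [phi [s [oJ phiJ rs sJ]]]] := time_change (r := r) oI w0 w_smooth.
- by move=> t /rI[].
- by move=> t /Dv dvt.
exists J, s; split => //; first by exists phi.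
move=> u /sJ[t It [srt ds d2s]]; exists t => //; split => //.
have dvt := Dv _ It.
apply: is_derive_eq d2s _; rewrite derive1E (@derive_val _ _ _ _ _ _ _ dvt).
by rewrite scalerA -expr2 exprVn.
Qed.

(** * Geodesics of a conformally flat metric *)

Lemma christoffel_conformal (R : realType) (lam : 'rV[R]_2 -> R)
    (x : 'rV[R]_2) (k i j : 'I_2) :
  differentiable lam x ->
  christoffel (fun y => lam y *: 1%:M) k i j x =
  (2 * lam x)^-1 * ((j == k)%:R * partial i lam x
    + (i == k)%:R * partial j lam x - (i == j)%:R * partial k lam x).
Proof.
move=> dlam.
have entry a b c : partial a (fun y => (lam y *: (1%:M : 'M[R]_2)) b c) x =
    (b == c)%:R * partial a lam x.
  rewrite /partial; have -> : (fun y => (lam y *: (1%:M : 'M[R]_2)) b c) =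
      (b == c)%:R *: lam.
    by apply/funext => y; rewrite !mxE mulrC.
  by rewrite deriveZ//; exact/diff_derivable.
rewrite /christoffel scalemx1 invmx_scalar (bigD1 k)//= big1 ?addr0.
  by rewrite !entry mxE eqxx mulr1n invfM mulrA.
by move=> l lk; rewrite mxE eq_sym (negPf lk) mulr0n mul0r.
Qed.

Lemma conformal_spray (R : realType) (lam : 'rV[R]_2 -> R) (x v : 'rV[R]_2)
    (k : 'I_2) :
  differentiable lam x ->
  \sum_(i < 2) \sum_(j < 2)
    christoffel (fun y => lam y *: 1%:M) k i j x * v 0 i * v 0 j =
  (2 * lam x)^-1 * (2 * dot (gradient lam x) v * v 0 k
    - dot v v * gradient lam x 0 k).
Proof.
move=> dlam; rewrite /dot !big_ord_recl !big_ord0 !christoffel_conformal//.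
rewrite !mxE.
case: k => -[|[|//]] p; rewrite -!val_eqE/=.
  by rewrite (_ : Ordinal p = ord0); [ring|exact/val_inj].
by rewrite (_ : Ordinal p = lift ord0 ord0); [ring|exact/val_inj].
Qed.

(** * The Jacobi-Maupertuis metric *)

Lemma regular_hill_regionP (R : realType) (V : 'rV[R]_2 -> \bar R) (E : R) x :
  regular_hill_region V E x <-> ~ collision V x /\ potential V x < E.
Proof.
rewrite /regular_hill_region /collision /potential /hill_region /hill_boundary /=.
case: (V x) => [p| |]/=; split.
- move=> [pE H]; split; first by case.
  rewrite lt_neqAle; move: pE; rewrite lee_fin => ->; rewrite andbT.
  by apply/eqP => pE; apply: H; left; rewrite pE.
- move=> [_ pE]; split; first by rewrite lee_fin ltW.
  by case=> [[pE']|[]//]; move: pE; rewrite pE' ltxx.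
- by case.
- by case=> H; exfalso; apply: H; left.
- by case=> _ H; exfalso; apply: H; right; right.
- by case=> H; exfalso; apply: H; right.
Qed.

(** The geodesic equation solved for the acceleration: the conformal factor is
    2 (E - V), with gradient -2 grad V. *)
Lemma jm_geodesicP (R : realType) (V : 'rV[R]_2 -> \bar R) (E : R)
    (x v a : 'rV[R]_2) :
  differentiable (potential V) x -> potential V x < E ->
  (forall k, a 0 k + \sum_(i < 2) \sum_(j < 2)
    christoffel (jm_metric V E) k i j x * v 0 i * v 0 j = 0) <->
  a = (2 * (E - potential V x))^-1 *:
      ((2 * dot (gradient (potential V) x) v) *: v
       - dot v v *: gradient (potential V) x).
Proof.
move=> dP PE; pose lam y := 2 * (E - potential V y).
have dEP : differentiable (cst E - potential V) x by exact: differentiableB.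
have dlam : differentiable lam x.
  by rewrite (_ : lam = 2 *: (cst E - potential V))//; exact: differentiableZ.
have gE : gradient lam x = (- 2) *: gradient (potential V) x.
  apply/rowP => i; rewrite !mxE /partial.
  rewrite (_ : lam = 2 *: (cst E - potential V))//.
  rewrite deriveZ ?deriveB ?derive_cst//; try exact: diff_derivable.
  by rewrite /GRing.scale/=; ring.
have lam0 : lam x != 0 by rewrite mulf_neq0// gt_eqF// subr_gt0.
have eqk k : (a 0 k + \sum_(i < 2) \sum_(j < 2)
    christoffel (jm_metric V E) k i j x * v 0 i * v 0 j = 0) <->
    a 0 k = ((lam x)^-1 *:
      ((2 * dot (gradient (potential V) x) v) *: v
       - dot v v *: gradient (potential V) x)) 0 k.
  rewrite (@conformal_spray _ lam)// gE (dotC _ v) dotZr (dotC v) !mxE.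
  split=> [/eqP|->]; last by field.
  by rewrite addr_eq0 => /eqP ->; field.
by split=> [H|aE k]; [apply/rowP => k; exact/eqk|apply/eqk; rewrite aE].
Qed.

Lemma energyE (R : realType) (V : 'rV[R]_2 -> \bar R) (q : R -> 'rV[R]_2) t :
  energy V q t = 2^-1 * dot (derive1 q t) (derive1 q t) + potential V (q t).
Proof. by rewrite /energy; congr (_ * _ + _); apply: eq_bigr => i _; rewrite expr2. Qed.

(** With energy E the squared speed is S = 2 (E - V), the conformal factor
    itself. In the time with rate S the velocity becomes q'/S, of squared norm
    1/S, and inserting q'' = - grad V in the formula for the new acceleration
    yields the geodesic equation. *)
Lemma newton_to_geodesic (R : realType) (V : 'rV[R]_2 -> \bar R) (E : R)
    (I : set R) (q : R -> 'rV[R]_2) :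
  smooth_on (~` collision V) (potential V) ->
  open_interval I -> energy_solution V E I q ->
  (forall t, I t -> ~ brake q t) ->
  exists (J : set R) (c : R -> 'rV[R]_2),
    [/\ open_interval J,
        geodesic (regular_hill_region V E) (jm_metric V E) J c
      & reparameterization I q J c].
Proof.
move=> sV oI [newton energyq] nobrake.
have q'0 t : I t -> derive1 q t != 0 by move=> /nobrake/eqP.
have acc i : exists2 a, along_curve (~` collision V) q a &
    forall t, I t -> derive1 (derive1 q) t 0 i = a t.
  exists (cst (-1) * (fun t => gradient (potential V) (q t) 0 i)).
    by apply: AlongMul; [exact: AlongCst|exact: along_curve_gradient].
  by move=> t /newton[_ _ _ ->]; rewrite !fctE !mxE mulN1r.
have [|J [c [oJ qc cJ]]] := speed_time_change oI ltr01 _ acc q'0.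
  by move=> t /newton[].
exists J, c; split => // u /cJ[t It [cu dc d2c]].
have [Dt _ _ q''] := newton _ It.
have S0 : 0 < dot (derive1 q t) (derive1 q t) by rewrite dot_gt0 q'0.
have lamE : 2 * (E - potential V (q t)) = dot (derive1 q t) (derive1 q t).
  have := energyq _ It; rewrite energyE; lra.
have PE : potential V (q t) < E.
  by move: S0; rewrite -lamE; lra.
split => //; [by apply/regular_hill_regionP; rewrite cu|].
apply/jm_geodesicP; rewrite cu//; first exact: smooth_on_differentiable Dt.
rewrite !derive1E (@derive_val _ _ _ _ _ _ _ d2c) (@derive_val _ _ _ _ _ _ _ dc).
rewrite lamE q'' mul1r; apply/rowP => k.
rewrite !(dotNr, dotZr) (dotC (_ *: _)) dotZr (dotC _ (derive1 q t)) !mxE.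
by field; rewrite gt_eqF.
Qed.

(** The Riemannian squared speed is conserved. In its derivative the term
    -2 (grad V . c') |c'|^2 from the conformal factor cancels against the
    product of 2 (E - V) with 2 c' . c'', read off from the geodesic
    equation. *)
Lemma jm_speed_constant (R : realType) (V : 'rV[R]_2 -> \bar R) (E : R)
    (J : set R) (c : R -> 'rV[R]_2) :
  smooth_on (~` collision V) (potential V) ->
  open_interval J ->
  geodesic (regular_hill_region V E) (jm_metric V E) J c ->
  exists e, forall s, J s ->
    2 * (E - potential V (c s)) * dot (derive1 c s) (derive1 c s) = e.
Proof.
move=> sV oJ geoc; have [_ _ [b Jb]] := oJ.
pose h s := 2 * (E - potential V (c s)) * dot (derive1 c s) (derive1 c s).
exists (h b) => s Js; apply: (derivative0_constant (h := h) oJ) => // {s Js} s Js.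
have [/regular_hill_regionP[Ds PE] /is_derive_derive1 dc /is_derive_derive1 d2c geo] := geoc _ Js.
have dP := smooth_on_differentiable sV Ds.
have {geo} c'' := (jm_geodesicP _ _ dP PE).1 geo.
have Dlam : is_derive s 1 (2 *: (cst E - potential V \o c))
    (2 *: (0 - dot (gradient (potential V) (c s)) (derive1 c s))).
  have dPc := is_derive_along dP dc.
  exact: (is_deriveZ 2 (is_deriveB (is_derive_cst _ _ _) dPc)).
apply: is_derive_eq (is_deriveM Dlam (is_derive_dot d2c d2c)) _.
rewrite (dotC (derive1 (derive1 c) s)) c'' /GRing.scale/= !fctE.
rewrite dotZr dotDr dotNr !dotZr (dotC (gradient _ _)).
by rewrite /GRing.scale/=; field; rewrite gt_eqF// subr_gt0.
Qed.

(** Let e = 2 (E - V) |c'|^2 be the conserved Riemannian speed squared; it is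
    positive as c is not constant. In the time with rate |c'|^2 / sqrt e the
    squared Euclidean speed becomes e / |c'|^2 = 2 (E - V), which says that the
    energy is E. In the geodesic acceleration the multiple of c' is
    cancelled by the time change, and the other term becomes - grad V. *)
Lemma geodesic_to_newton (R : realType) (V : 'rV[R]_2 -> \bar R) (E : R)
    (J : set R) (c : R -> 'rV[R]_2) :
  smooth_on (~` collision V) (potential V) ->
  open_interval J ->
  geodesic (regular_hill_region V E) (jm_metric V E) J c ->
  ~ (exists p, forall s, J s -> c s = p) ->
  exists (I : set R) (q : R -> 'rV[R]_2),
    [/\ open_interval I, energy_solution V E I q & reparameterization J c I q].
Proof.
move=> sV oJ geoc ncst.
have [e He] := jm_speed_constant sV oJ geoc.
have EP0 s : J s -> 0 < E - potential V (c s).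
  by move=> /geoc[/regular_hill_regionP[_ PE] _ _ _]; rewrite subr_gt0.
have lam0 s : J s -> 0 < 2 * (E - potential V (c s)).
  by move=> /EP0; rewrite pmulr_rgt0.
(* A curve with velocity zero everywhere on an interval is constant. *)
have [s0 Js0 c's0] : exists2 s, J s & derive1 c s != 0.
  apply: contrapT => H; apply: ncst; have [_ _ [b Jb]] := oJ.
  exists (c b) => s Js; apply/rowP => i.
  apply: (derivative0_constant (h := fun x => c x 0 i) oJ) => // x Jx.
  have [_ /is_derive_derive1/is_derive_row/(_ i) dc _ _] := geoc _ Jx.
  apply: is_derive_eq dc _; have [->|c'x] := eqVneq (derive1 c x) 0; first by rewrite mxE.
  by exfalso; apply: H; exists x.
have e0 : 0 < e by rewrite -(He _ Js0) mulr_gt0 ?lam0// dot_gt0.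
have S0 s : J s -> 0 < dot (derive1 c s) (derive1 c s).
  by move=> Js; move: e0; rewrite -(He _ Js) pmulr_rgt0// lam0.
have c'0 s : J s -> derive1 c s != 0 by move=> /S0; rewrite dot_gt0.
have c'' s : J s -> derive1 (derive1 c) s = (2 * (E - potential V (c s)))^-1 *:
      ((2 * dot (gradient (potential V) (c s)) (derive1 c s)) *: derive1 c s
       - dot (derive1 c s) (derive1 c s) *: gradient (potential V) (c s)).
  move=> Js; have [/regular_hill_regionP[Ds PE] _ _ geo] := geoc _ Js.
  by apply/jm_geodesicP => //; exact: smooth_on_differentiable Ds.
have acc i : exists2 a, along_curve (~` collision V) c a &
    forall t, J t -> derive1 (derive1 c) t 0 i = a t.
  pose S t := dot (derive1 c t) (derive1 c t).
  pose G t := dot (gradient (potential V) (c t)) (derive1 c t).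
  have AS : along_curve (~` collision V) c S.
    by apply: along_curve_dot => j; exact: AlongVelocity.
  have AG : along_curve (~` collision V) c G.
    by apply: along_curve_dot => j; [exact: along_curve_gradient|exact: AlongVelocity].
  (* The algebra contains no inverses; the factor (2 (E - V))^-1 of the geodesic
     equation is replaced by the polynomial e^-1 S, equal to it by conservation
     of the Riemannian speed. *)
  exists (cst e^-1 * S * (cst 2 * G * (fun t => derive1 c t 0 i)
      + cst (-1) * S * (fun t => gradient (potential V) (c t) 0 i))).
    have Av := AlongVelocity (~` collision V) c i.
    have Ag := along_curve_gradient c i sV.
    by do ?[apply: AlongMul|apply: AlongAdd] => //; exact: AlongCst.
  move=> t Jt; rewrite c''// !fctE !mxE -(He _ Jt) -/(S t) -/(G t).
  have := EP0 _ Jt; have : 0 < S t by exact: S0.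
  by move=> St EPt; field; rewrite !gt_eqF.
have k0 : 0 < (Num.sqrt e)^-1 by rewrite invr_gt0 sqrtr_gt0.
have [|I [q [oI cq qI]]] := speed_time_change oJ k0 _ acc c'0.
  by move=> s /geoc[/regular_hill_regionP[]].
exists I, q; split => //.
have k2 : (Num.sqrt e)^-1 ^+ 2 = e^-1 by rewrite exprVn sqr_sqrtr// ltW.
split=> u /qI[t Jt [qu dq d2q]].
  have [/regular_hill_regionP[Dt PE] _ _ _] := geoc _ Jt.
  split => //; first by rewrite qu.
  rewrite qu derive1E (@derive_val _ _ _ _ _ _ _ d2q) c''// exprMn k2 -(He _ Jt).
  have St := S0 _ Jt; have EPt := EP0 _ Jt; apply/rowP => k.
  rewrite dotZr dotDr dotNr !dotZr (dotC (gradient _ _)) !mxE.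
  by field; rewrite !gt_eqF.
rewrite energyE qu derive1E (@derive_val _ _ _ _ _ _ _ dq).
rewrite dotZr (dotC (_ *: _)) dotZr mulrA -expr2 exprVn exprMn k2 -(He _ Jt).
have St := S0 _ Jt; have EPt := EP0 _ Jt.
by field; rewrite !gt_eqF.
Qed.

(** * The correspondence *)

Theorem theorem2 (R : realType) (V : 'rV[R]_2 -> \bar R) (E : R)
    (V_continuous : continuous V)
    (V_smooth : smooth_on (~` collision V) (potential V)) :
  (forall (I : set R) (q : R -> 'rV[R]_2),
     open_interval I ->
     energy_solution V E I q ->
     (forall t, I t -> ~ brake q t) ->
     exists (J : set R) (c : R -> 'rV[R]_2),
       [/\ open_interval J,
           geodesic (regular_hill_region V E) (jm_metric V E) J c
         & reparameterization I q J c])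
  /\
  (forall (J : set R) (c : R -> 'rV[R]_2),
     open_interval J ->
     geodesic (regular_hill_region V E) (jm_metric V E) J c ->
     ~ (exists p, forall s, J s -> c s = p) ->
     exists (I : set R) (q : R -> 'rV[R]_2),
       [/\ open_interval I,
           energy_solution V E I q
         & reparameterization J c I q]).
Proof.
split=> [I q oI solq nobrake|J c oJ geoc ncst].
  exact: newton_to_geodesic solq nobrake.
exact: geodesic_to_newton geoc ncst.
Qed.
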